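(* Let $K$ be a right Bol loop, $G$ a group with identity $e$, and $\chi:\mathcal{G}_r(K)\to G$ a homomorphism of the group generated by the right translations of $K$ to $G$. The Schreier extension $K\times_e^{\Theta}G$ determined by $$f(\tau,\sigma)=e,\quad\tau,\sigma\in K,\qquad \Theta_\sigma=\iota_{\chi(\rho_\sigma)},\quad\sigma\in K,\qquad \iota_g(h)=ghg^{-1},\quad g,h\in G,$$ has the following properties: (i) it is a right Bol loop; (ii) it is left nuclear if and only if the image $\chi(\mathcal{H}_r(K))$ of $\mathcal{H}_r(K)\subset\mathcal{G}_r(K)$ is contained in the centre of $G$; (iii) it is a group if and only if $K$ is a group.
   Context: A right Bol loop is a loop satisfying $z(xy\cdot x)=(zx\cdot y)x$. For a loop $K$ with identity $\epsilon$, $\rho_\sigma:K\to K$, $\rho_\sigma x=x\sigma$, is the right translation (compositions are applied right to left); $\mathcal{G}_r(K)$ is the group generated by all $\rho_\sigma$, $\sigma\in K$, and the right inner mapping group $\mathcal{H}_r(K)$ is the subgroup generated by the maps $\rho_{\tau\sigma}^{-1}\rho_\sigma\rho_\tau$, $\sigma,\tau\in K$. For maps $f:K\times K\to G$ and $\Theta:K\to\mathrm{Aut}(G)$ with $f(\sigma,\epsilon)=f(\epsilon,\sigma)=e$ and $\Theta_\epsilon=\mathrm{Id}$, the Schreier extension $K\times_f^{\Theta}G$ is the loop on $K\times G$ with multiplication $(\sigma,s)(\tau,t)=(\sigma\tau,f(\sigma,\tau)\Theta_\tau(s)t)$; $K\times_e^{\Theta}G$ denotes the case of constant $f=e$. It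 is left nuclear if $\{\epsilon\}\times G$ is contained in the left nucleus $\{u: ux\cdot y=u\cdot xy\ \forall x,y\}$. *)

(* Defs.v *)
(* Loops are on arbitrary types; the choice structure carried by groupType
   exists classically on every type. *)
From HB Require Import structures.
From mathcomp Require Import all_boot.
From mathcomp Require Import boolp classical_sets.

Set Implicit Arguments.
Unset Strict Implicit.
Unset Printing Implicit Defensive.

Local Open Scope classical_set_scope.
Local Open Scope group_scope.

Definition is_loop (L : baseUMagmaType) : Prop :=
  [/\ left_id 1 (@mul L), right_id 1 (@mul L),
      forall a b : L, exists! x, a * x = b
    & forall a b : L, exists! y, y * a = b].

HB.mixin Record BaseUMagma_isLoop L of BaseUMagma L := {
  loopP : is_loop L
}.

#[short(type="loopType")]
HB.structure Definition Loop := {L of BaseUMagma L & BaseUMagma_isLoop L}.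

Definition right_bol_loop (L : baseUMagmaType) : Prop :=
  is_loop L /\ forall x y z : L, z * ((x * y) * x) = ((z * x) * y) * x.

Definition is_group (L : baseUMagmaType) : Prop :=
  [/\ associative (@mul L), left_id 1 (@mul L), right_id 1 (@mul L)
    & forall x : L, exists y, y * x = 1 /\ x * y = 1].

Definition left_nucleus (L : magmaType) : set L :=
  [set u | forall x y, (u * x) * y = u * (x * y)].

Definition center (G : groupType) : set G := [set c | forall g, commute c g].
Arguments center : clear implicits.

(* Permutations of a possibly infinite type.  The product is composition
   from right to left, opposite to that of {perm T}. *)
Record sym (T : Type) := Sym { sym_fun :> T -> T; sym_bij : bijective sym_fun }.

Lemma symP (T : Type) (p q : sym T) : p =1 q -> p = q.
Proof.
case: p q => [p bp] [q bq] /= /funext epq; case: _ / epq bq => bq.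
by rewrite (Prop_irrelevance bp bq).
Qed.

HB.instance Definition _ (T : Type) := gen_eqMixin (sym T).
HB.instance Definition _ (T : Type) := gen_choiceMixin (sym T).

Section SymGroup.
Variable T : Type.
Implicit Types p q r : sym T.

Definition sym_one : sym T := Sym (Bijective (frefl idfun) (frefl idfun)).

Definition sym_mul p q : sym T := Sym (bij_comp (sym_bij p) (sym_bij q)).

Lemma sym_inv_subproof p : {q : sym T | cancel p q /\ cancel q p}.
Proof.
apply: cid; case: p => p /= [q pK qK].
by exists (Sym (Bijective qK pK)).
Qed.

Definition sym_inv p : sym T := sval (sym_inv_subproof p).

Lemma sym_mulA : associative sym_mul.
Proof. by move=> p q r; apply: symP. Qed.

Lemma sym_mul1 : left_id sym_one sym_mul.
Proof. by move=> p; apply: symP. Qed.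

Lemma sym_1mul : right_id sym_one sym_mul.
Proof. by move=> p; apply: symP. Qed.

Lemma sym_mulV : left_inverse sym_one sym_inv sym_mul.
Proof.
by move=> p; apply: symP => x /=; apply: (svalP (sym_inv_subproof p)).1.
Qed.

Lemma sym_Vmul : right_inverse sym_one sym_inv sym_mul.
Proof.
by move=> p; apply: symP => x /=; apply: (svalP (sym_inv_subproof p)).2.
Qed.

HB.instance Definition _ :=
  isGroup.Build (sym T) sym_mulA sym_mul1 sym_1mul sym_mulV sym_Vmul.

End SymGroup.

Section GeneratedSubgroup.
Variables (H : groupType) (A : set H).

Definition gen : set H := smallest (fun S : set H => group_closed [in S]) A.

Lemma sub_gen : A `<=` gen.
Proof. exact: sub_gen_smallest. Qed.

Lemma gen_group_closed : group_closed [in gen].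
Proof.
split; first by rewrite !inE => S [[+ _] _]; rewrite !inE.
move=> x y; rewrite !inE => gx gy S SA.
have [_ SV] := SA.1.
by have := SV x y; rewrite !inE; apply; [apply: gx | apply: gy].
Qed.

(* The subgroup generated by A, as a group in its own right. *)
Record genG := GenG { gen_val : H; _ : gen_val \in gen }.

HB.instance Definition _ := [isSub for gen_val].
HB.instance Definition _ := [Choice of genG by <:].
HB.instance Definition _ :=
  SubChoice_isSubGroup.Build H [in gen] genG gen_group_closed.

Lemma genG_subproof a : A a -> a \in gen.
Proof. by move=> Aa; rewrite inE; apply: sub_gen. Qed.

End GeneratedSubgroup.

Section RightTranslations.
Variable K : loopType.
Implicit Types sigma tau : K.

Lemma rho_subproof sigma : bijective (fun x : K => x * sigma).
Proof.
have [_ _ _ /(_ sigma) dv] := @loopP K.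
have [g gP] := choice dv.
exists g => x; last exact: (gP x).1.
exact: (gP (x * sigma)).2.
Qed.

Definition rho sigma : sym K := Sym (rho_subproof sigma).

(* The group generated by the right translations, and below it the right
   inner mapping group, as a subgroup of Gr. *)
Definition Gr : groupType := genG (range rho).

Definition rhoG sigma : Gr := GenG (genG_subproof (imageT rho sigma)).

Definition Hr : set Gr :=
  gen [set h | exists sigma tau,
         h = (rhoG (tau * sigma))^-1 * rhoG sigma * rhoG tau].

End RightTranslations.

Arguments Hr : clear implicits.

Record aut (G : groupType) :=
  Aut { aut_fun :> {multiplicative G -> G}; aut_bij : bijective aut_fun }.

Section InnerAutomorphism.
Variables (G : groupType) (g : G).

(* Conjugation on the left: inner h = h ^ g^-1 in the library's notation. *)
Definition inner (h : G) : G := g * h * g^-1.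

Lemma inner_multiplicative x y : inner (x * y) = inner x * inner y.
Proof. by rewrite /inner !mulgA mulgVK. Qed.

HB.instance Definition _ := isMultiplicative.Build G G inner inner_multiplicative.

Lemma inner_bij : bijective inner.
Proof.
exists (fun h => g^-1 * h * g) => h; rewrite /inner !mulgA.
  by rewrite mulVg mul1g mulgVK.
by rewrite mulgV mul1g mulgK.
Qed.

Definition iota : aut G := Aut inner_bij.

End InnerAutomorphism.

Record schreier_data (K : baseUMagmaType) (G : groupType) := SchreierData {
  sch_f : K -> K -> G;
  sch_Theta : K -> aut G;
  sch_fs1 : forall sigma, sch_f sigma 1 = 1;
  sch_f1s : forall sigma, sch_f 1 sigma = 1;
  sch_Theta1 : sch_Theta 1 =1 id
}.

(* An alias, so that its product is not the componentwise one of K * G. *)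
Definition schreier (K : baseUMagmaType) (G : groupType)
  (D : schreier_data K G) : Type := (K * G)%type.

Section SchreierExtension.
Variables (K : baseUMagmaType) (G : groupType) (D : schreier_data K G).

Definition schreier_mul (u v : schreier D) : schreier D :=
  (u.1 * v.1, sch_f D u.1 v.1 * sch_Theta D v.1 u.2 * v.2).

HB.instance Definition _ := hasMul.Build (schreier D) schreier_mul.
HB.instance Definition _ := hasOne.Build (schreier D) (1 : K, 1 : G).

Definition left_nuclear : Prop :=
  ([set 1] `*` [set: G] : set (schreier D)) `<=` @left_nucleus (schreier D).

End SchreierExtension.

Section InnerExtension.
Variables (K : loopType) (G : groupType) (chi : {multiplicative Gr K -> G}).

Lemma inner_Theta1 : iota (chi (rhoG (1 : K))) =1 id.
Proof.
have -> : rhoG (1 : K) = 1.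
  by apply: val_inj; apply: symP => x /=; case: (@loopP K).
have -> : chi 1 = 1 by apply: (mulgI (chi 1)); rewrite -gmulfM !mulg1.
by move=> h /=; rewrite /inner mul1g invg1 mulg1.
Qed.

(* The choice f = 1, Theta_sigma = iota_(chi rho_sigma). *)
Definition inner_data : schreier_data K G :=
  @SchreierData K G (fun _ _ => 1) (fun sigma => iota (chi (rhoG sigma)))
    (fun _ => erefl) (fun _ => erefl) inner_Theta1.

End InnerExtension.

(* Main.v *)
(* Write c sigma = chi (rho sigma).  The product of the extension is
   (sigma, s)(tau, t) = (sigma tau, c_tau s c_tau^-1 t), so each loop law of the
   extension reduces to the same law of K together with a relation in G between
   values of c.  For the right Bol law this relation is
   c ((x y) x) = c x * c y * c x, the image under chi of
   rho ((x y) x) = rho x * rho y * rho x, which is the right Bol law of K.  For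
   associativity it is c (x y) = c y * c x; if it is required only when the left
   factor is (1, g), it says that g commutes with (c (x y))^-1 * c y * c x, the
   image of a generator of Hr K. *)
Require Import Defs.
From mathcomp Require Import all_boot.
From mathcomp Require Import boolp classical_sets.

Local Open Scope classical_set_scope.

(** The right inverse [y] and the left inverse [z] given by division agree:
    [y = (z * x) * y = z * (x * y) = z]. *)
Lemma associative_loop_is_group (L : baseUMagmaType) :
  is_loop L -> associative (@mul L) -> is_group L.
Proof.
move=> [l1 r1 ldiv rdiv] mA; split=> // x.
have [y [xy _]] := ldiv x 1%g; have [z [zx _]] := rdiv x 1%g.
have yz : y = z by rewrite -[LHS]l1 -zx -mA xy r1.
by exists z; split=> //; rewrite -yz.
Qed.

Lemma multiplicative1 (H G : groupType) (f : {multiplicative H -> G}) :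
  f 1%g = 1%g.
Proof. by apply: (mulgI (f 1%g)); rewrite -gmulfM !mulg1. Qed.

Lemma multiplicativeV (H G : groupType) (f : {multiplicative H -> G}) (x : H) :
  f (x^-1)%g = ((f x)^-1)%g.
Proof. by apply: (mulgI (f x)); rewrite -gmulfM !mulgV multiplicative1. Qed.

(** As [Hr] is the smallest [group_closed] set containing its generators, this lets centrality of
    its image be checked on generators alone. *)
Lemma group_closed_center_preimage (H G : groupType)
    (f : {multiplicative H -> G}) :
  group_closed [in f @^-1` center G].
Proof.
split.
  by rewrite !inE /= multiplicative1 => g; apply: commute_sym; apply: commute1.
move=> x y; rewrite !inE /= => cx cy g; apply: commute_sym.
rewrite gmulfM multiplicativeV; apply: commuteM; first exact/commute_sym.
by apply: commuteV; apply/commute_sym.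
Qed.

Section InnerExtensionTheory.
Variables (K : loopType) (G : groupType) (chi : {multiplicative Gr K -> G}).
Local Open Scope group_scope.

Let D := inner_data chi.
Let c (sigma : K) : G := chi (rhoG sigma).
Let E : baseUMagmaType := schreier D.

Lemma inner_extension_mulE (u v : E) :
  u * v = (u.1 * v.1, c v.1 * u.2 * (c v.1)^-1 * v.2) :> E.
Proof. by congr (_, _); rewrite /= /inner mul1g. Qed.

Lemma chi_rho1 : c 1 = 1.
Proof.
rewrite -(multiplicative1 _ _ chi); congr (chi _).
by apply: val_inj; apply: symP => x /=; case: (@loopP K).
Qed.

Lemma inner_extension_loop : is_loop E.
Proof.
have [l1 r1 ldiv rdiv] := @loopP K; split.
- case=> y t.
  by rewrite [LHS]inner_extension_mulE /= l1 mulg1 mulgV mul1g.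
- case=> y t.
  by rewrite [LHS]inner_extension_mulE /= r1 chi_rho1 invg1 mul1g !mulg1.
- move=> [a s] [b t]; have [x [ax ux]] := ldiv a b.
  exists (x, (c x * s * (c x)^-1)^-1 * t); split.
    by rewrite inner_extension_mulE /= ax mulgA mulgV mul1g.
  case=> y r; rewrite inner_extension_mulE /= => -[ay <-].
  by rewrite (ux _ ay) mulgA mulVg mul1g.
- move=> [a s] [b t]; have [y [ya uy]] := rdiv a b.
  (* The second component solves [c a * w * (c a)^-1 * s = t] for [w]. *)
  exists (y, (c a)^-1 * (t * s^-1) * c a); split.
    by rewrite inner_extension_mulE /= ya !mulgA mulgV mul1g mulgK mulgVK.
  case=> x r; rewrite inner_extension_mulE /= => -[xa <-].
  by rewrite (uy _ xa) mulgK !mulgA mulVg mul1g mulgVK.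
Qed.

Lemma chi_rho_bol (x y : K) :
  right_bol_loop K -> c ((x * y) * x) = c x * c y * c x.
Proof.
case=> _ bol; rewrite /c -!gmulfM; congr (chi _).
by apply: val_inj; apply: symP => z; apply: bol.
Qed.

(** Maps compose from right to left, so in the associative case [rho] reverses products. *)
Lemma chi_rho_assoc (x y : K) :
  associative (@mul K) -> c (x * y) = c y * c x.
Proof.
move=> mA; rewrite /c -gmulfM; congr (chi _).
by apply: val_inj; apply: symP => z; apply: mA.
Qed.

Lemma inner_extension_right_bol : right_bol_loop K -> right_bol_loop E.
Proof.
move=> bolK; split; first exact: inner_extension_loop.
move=> [x s] [y t] [z r]; rewrite !inner_extension_mulE /=.
rewrite bolK.2 chi_rho_bol //.
by congr (_, _); rewrite !invgM !mulgA !mulgVK.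
Qed.

Lemma chi_Hr_generator (x y : K) :
  chi ((rhoG (x * y))^-1 * rhoG y * rhoG x) = (c (x * y))^-1 * c y * c x.
Proof. by rewrite !gmulfM multiplicativeV. Qed.

Lemma left_nucleus_inner_extension (g : G) :
  left_nucleus ((1, g) : E) <->
  forall x y : K, commute ((c (x * y))^-1 * c y * c x) g.
Proof.
have [l1 _ _ _] := @loopP K; split.
  move=> nuc x y.
  (* Second components 1 lose nothing: arbitrary ones would cancel from both sides. *)
  have := nuc ((x, 1) : E) ((y, 1) : E).
  rewrite !inner_extension_mulE /= => -[_]; rewrite !mulg1 mulgV mulg1 !mulgA => eq_g.
  apply: (mulgI (c (x * y))); apply: (mulIg (c x)^-1); apply: (mulIg (c y)^-1).
  by rewrite !mulgA mulgV mul1g eq_g !mulgK.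
move=> comm_g [x s] [y t]; rewrite !inner_extension_mulE /= !l1.
congr (_, _); rewrite !mulgA; congr (_ * _ * _ * _).
(* With the common right factors [s], [(c y)^-1] and [t] removed, the goal is this relation
   multiplied by [c (x * y)] on the left and [(c x)^-1] on the right. *)
have /(congr1 (mul (c (x * y)))) := comm_g x y.
rewrite /commute !mulgA mulgV mul1g => ->.
by rewrite mulgK.
Qed.

Lemma left_nuclear_inner_extension :
  left_nuclear D <-> chi @` Hr K `<=` center G.
Proof.
split.
  move=> nuc _ [h Hh <-].
  apply: (Hh (chi @^-1` center G)); split.
    exact: group_closed_center_preimage.
  move=> _ [y [x ->]] g; rewrite chi_Hr_generator.
  by apply: (left_nucleus_inner_extension g).1; apply: nuc.
move=> Hc [_ g] [/= -> _]; apply/left_nucleus_inner_extension => x y.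
rewrite -chi_Hr_generator; apply: Hc; apply: imageP; apply: sub_gen.
by exists y, x.
Qed.

Lemma inner_extension_is_group : is_group E <-> is_group K.
Proof.
split=> -[mA _ _ _]; apply: associative_loop_is_group.
- exact: loopP.
(* The first projection respects products, so associativity descends to [K]. *)
- by move=> x y z; case: (mA ((x, 1) : E) ((y, 1) : E) ((z, 1) : E)).
- exact: inner_extension_loop.
- move=> [x s] [y t] [z r]; rewrite !inner_extension_mulE /=.
  rewrite mA chi_rho_assoc //.
  by congr (_, _); rewrite !invgM !mulgA !mulgVK.
Qed.

End InnerExtensionTheory.

Theorem proposition35 (K : loopType) (G : groupType)
    (chi : {multiplicative Gr K -> G}) :
  right_bol_loop K ->
  let D := inner_data chi in
  [/\ right_bol_loop (schreier D),
      left_nuclear D <-> chi @` Hr K `<=` center G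
    & is_group (schreier D) <-> is_group K].
Proof.
move=> bolK D; split.
- exact: inner_extension_right_bol.
- exact: left_nuclear_inner_extension.
- exact: inner_extension_is_group.
Qed.
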